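(* Let $r,z\ge 1$ be integers and let $G$ be an almost mixed Moore graph of diameter two with undirected degree $r$ and directed out-degree $z$, i.e. an $(r,z,2;-1)$-graph: a mixed graph with maximum undirected degree $r$, maximum directed out-degree $z$, diameter $2$ and order $(r+z)^2+z$. Then $G$ is totally regular.
   Context: A mixed graph $G$ consists of a finite set $V(G)$ of vertices, a set $E(G)$ of unordered pairs of vertices (edges, $u\sim v$) and a set $A(G)$ of ordered pairs (arcs, $u\to v$). There are no loops and no parallel edges or arcs, and $u\sim v$ and $u\to v$ cannot hold simultaneously. Mixed graphs are assumed proper: both $E(G)$ and $A(G)$ are non-empty. The undirected degree of $u$ is $d(u)=|\{v:u\sim v\}|$, the directed out-degree is $d^+(u)=|\{v:u\to v\}|$ and the directed in-degree is $d^-(u)=|\{v:v\to u\}|$. The in-degrees are not constrained a priori. The distance from $u$ to $v$ is the length of a shortest path from $u$ to $v$, where each step follows an edge (in either direction) or an arc (in its direction); the diameter is $\max\{d(u,v):u,v\in V(G)\}$. The mixed Moore bound for $k=2$ is $M(r,z,2)=(r+z)^2+z+1$; an $(r,z,2;-1)$-graph has order $M(r,z,2)-1$. $G$ is out-regular if $d(u)=d(v)$ and $d^+(u)=d^+(v)$ for all vertices $u,v$; it is totally regular if it is out-regular and $d^-(u)=d^+(u)$ for every vertex $u$. *)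

(* Defs.v *)
From mathcomp Require Import all_boot.
Set Implicit Arguments.
Unset Strict Implicit.
Unset Printing Implicit Defensive.

(* An edge {u, v} is encoded by [edge u v] and [edge v u].  Using relations
   rules out parallel edges and parallel arcs; the pair of opposite arcs
   u -> v, v -> u consists of two distinct ordered pairs and is allowed. *)
Record mixed_graph (V : finType) := MixedGraph {
  edge : rel V;
  arc : rel V;
  edge_sym : symmetric edge;
  edge_irr : irreflexive edge;
  arc_irr : irreflexive arc;
  edge_arc_excl : forall u v, edge u v -> ~~ arc u v
}.

Section MixedGraph.
Variables (V : finType) (G : mixed_graph V).

Definition proper_mixed : Prop :=
  (exists u v, edge G u v) /\ (exists u v, arc G u v).

Definition undirected_degree (u : V) : nat := #|[set v | edge G u v]|.
Definition out_degree (u : V) : nat := #|[set v | arc G u v]|.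
Definition in_degree (u : V) : nat := #|[set v | arc G v u]|.

Definition step : rel V := [rel u v | edge G u v || arc G u v].

(* Vertices may repeat here, which does not affect shortest lengths. *)
Definition walk_of_length (k : nat) (u v : V) : Prop :=
  exists p : seq V, [/\ path step u p, last u p = v & size p = k].

Definition is_distance (u v : V) (k : nat) : Prop :=
  walk_of_length k u v /\ forall m, walk_of_length m u v -> k <= m.

(* In particular every vertex is reachable from every other one: an infinite
   distance would make the maximum infinite. *)
Definition has_diameter (k : nat) : Prop :=
  (forall u v, exists2 d, is_distance u v d & d <= k) /\
  (exists u v, is_distance u v k).

Definition max_undirected_degree : nat := \max_(u : V) undirected_degree u.
Definition max_out_degree : nat := \max_(u : V) out_degree u.

Definition out_regular : Prop :=
  forall u v, undirected_degree u = undirected_degree v /\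
              out_degree u = out_degree v.

Definition totally_regular : Prop :=
  out_regular /\ forall u, in_degree u = out_degree u.

End MixedGraph.

(* The mixed Moore bound M(r, z, 2). *)
Definition mixed_moore_bound2 (r z : nat) : nat := (r + z) ^ 2 + z + 1.

(* (r, z, 2; -1)-graphs *)
Definition almost_mixed_moore2 (V : finType) (G : mixed_graph V) (r z : nat)
  : Prop :=
  [/\ proper_mixed G,
      max_undirected_degree G = r,
      max_out_degree G = z,
      has_diameter G 2
    & #|V| = mixed_moore_bound2 r z - 1].

(* Main.v *)
From mathcomp Require Import all_boot all_order all_algebra.
From mathcomp Require Import zify ring.
Require Import Defs.
Set Implicit Arguments.
Unset Strict Implicit.
Unset Printing Implicit Defensive.
Import Order.TTheory GRing.Theory Num.Theory.

(** Why the theorem holds.  Put d = r + z and let A be the 0/1 matrix of the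
    relation u ~ v or u -> v.  From a vertex u there are at most d^2 + z + 1
    walks of length at most 2 that do not traverse an edge back and forth, they
    reach all d^2 + z vertices, and a missing edge or arc at u would cost too
    many of them.  So u has degrees exactly r and z ([degrees_maximal]), and
    exactly one vertex, its repeat [rep u], is reached twice
    ([repeat_exists]).  In matrix form A^2 + A = J + R + (r - 1) I, where R is
    the matrix of the map [rep].

    Let e(w) be the in-degree of w minus z; these numbers add up to 0.  Since A
    commutes with J + R, comparing A (J + R) with (J + R) A shows that the
    number of out-neighbours x of u with rep x = w is A(rep u, w) + e(w)
    ([sum_adj_rep]).  Adding up the columns of the matrix equation expresses
    the size of the fibre of [rep] over w through e ([fibreE]).

    Suppose that some e(w) is negative.  Then e(w) = -1, every repeat is
    adjacent to w, and w is no repeat ([deficientP]).  The column identity at w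
    makes the positive values of e add up to at least d, while the set S of
    vertices with e = -1 lies in the out-neighbourhood of a repeat, which has d
    elements.  As e has sum 0, the two bounds meet and S is the
    out-neighbourhood of every repeat; by the commutation identity, the repeats
    are then exactly the vertices with e > 0.  Such a vertex x receives from S only its r edges
    ([adj_surplus_in]), since an arc y -> x with y in S would close the walk
    y -> x -> y and make y a repeat.  Adding the fibre sizes over the p repeats
    gives p r = p + r, and so r = 2 ([undirected_degree_eq2]).  Finally the
    trace of A^3 is d + (d^2 + z) z ([sum_closed_walks3]), which for d = z + 2
    is never a multiple of 3; but closed walks of length 3 in a loopless
    relation come in threes, one for each starting point
    ([dvd3_closed3]).  So no e(w) is negative, and they all vanish. *)

(** * Sums over a finite type *)

Section Sums.
Local Open Scope ring_scope.
Variable V : finType.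

Lemma sum_bool (P : pred V) : \sum_v (P v)%:R = #|[set v | P v]|%:R :> int.
Proof.
rewrite cardsE -sum1_card natr_sum [RHS]big_mkcond.
by apply: eq_bigr => v _; rewrite unfold_in; case: (P v).
Qed.

(** Summation against the indicator of a point; it evaluates both the identity
    matrix and the matrix of the repeat map inside a sum. *)
Lemma sum_delta (y : V) (f : V -> int) : \sum_x (x == y)%:R * f x = f y.
Proof.
rewrite (bigD1 y) //= eqxx mul1r big1 ?addr0 // => x /negbTE->.
by rewrite mul0r.
Qed.

Lemma sum_const (c : int) : \sum_(v : V) c = #|V|%:R * c.
Proof. by rewrite sumr_const mulr_natl. Qed.

(** Termwise inequalities whose total is tight are equalities.  This is how
    counting bounds that meet turn into structural information. *)
Lemma sum_le_eq (f g : V -> int) :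
  (forall x, f x <= g x) -> \sum_x g x <= \sum_x f x -> f =1 g.
Proof.
move=> fg gf x; apply/eqP; rewrite eq_sym -subr_eq0; apply/eqP.
apply: (@psumr_eq0P _ V xpredT (fun x => g x - f x)) => // [i _|].
  by rewrite subr_ge0.
rewrite sumrB; apply/eqP; rewrite subr_eq0 eq_le gf.
by apply: ler_sum.
Qed.

Lemma sum_one (f : V -> int) :
  (forall x, 0 <= f x) -> \sum_x f x = 1 ->
  exists y, forall x, f x = (x == y)%:R.
Proof.
move=> f0 f1; have [y fy|all0] := pickP (fun y => f y != 0); last first.
  by move: f1; rewrite big1 // => i _; apply/eqP; move: (all0 i) => /negbFE.
exists y => x; symmetry; move: x; apply: sum_le_eq => [x|].
  by case: eqP => [->|_] //; move: (f0 y) fy; lia.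
by rewrite f1 (bigD1 y) //= eqxx big1 // => x /negbTE->.
Qed.

End Sums.

(** * The adjacency matrix *)

Section Adjacency.
Local Open Scope ring_scope.
Variables (V : finType) (G : mixed_graph V).

Definition adj (u v : V) : int := (step G u v)%:R.

Definition walks2 (u v : V) : int := \sum_w adj u w * adj w v.

Lemma adj_ge0 u v : 0 <= adj u v. Proof. by rewrite ler0n. Qed.

Lemma adj_le1 u v : adj u v <= 1.
Proof. by rewrite /adj; case: (step _ _ _). Qed.

Lemma adjE u v : adj u v = (edge G u v)%:R + (arc G u v)%:R.
Proof.
rewrite /adj /step /=; have := @edge_arc_excl _ G u v.
by case: (edge G u v) => [/(_ isT)|_]; case: (arc G u v).
Qed.

Lemma sum_edge u : \sum_v (edge G u v)%:R = (undirected_degree G u)%:R :> int.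
Proof. exact: sum_bool. Qed.

Lemma sum_adj_out u :
  \sum_v adj u v = (undirected_degree G u)%:R + (out_degree G u)%:R.
Proof.
rewrite -sum_edge -[X in _ + X]sum_bool -big_split.
by apply: eq_bigr => v _; apply: adjE.
Qed.

Lemma sum_adj_in v :
  \sum_u adj u v = (undirected_degree G v)%:R + (in_degree G v)%:R.
Proof.
rewrite -sum_edge -[X in _ + X]sum_bool -big_split.
by apply: eq_bigr => u _; rewrite adjE edge_sym.
Qed.

Lemma walks2_assoc u v :
  \sum_x adj u x * walks2 x v = \sum_x walks2 u x * adj x v.
Proof.
under eq_bigr do rewrite mulr_sumr.
under [RHS]eq_bigr do rewrite mulr_suml.
rewrite exchange_big; apply: eq_bigr => y _; apply: eq_bigr => x _.
by rewrite mulrA.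
Qed.

Lemma sum_walks2 u : \sum_v walks2 u v = \sum_w adj u w * \sum_v adj w v.
Proof. by rewrite exchange_big; apply: eq_bigr => w _; rewrite mulr_sumr. Qed.

(** Every edge at u can be traversed back and forth. *)
Lemma closed_walks2_ge_degree u : (undirected_degree G u)%:R <= walks2 u u.
Proof.
rewrite -sum_edge; apply: ler_sum => v _.
have := adj_ge0 u v; have := adj_ge0 v u; rewrite !adjE (edge_sym G v u).
by case: (edge G u v); case: (arc G u v); case: (arc G v u).
Qed.

End Adjacency.

(** * Closed walks of length three *)

Section Triangles.
Variables (V : finType) (e : rel V).
Hypothesis e_irr : irreflexive e.

Definition closed3 : {set V * V * V} :=
  [set t | [&& e t.1.1 t.1.2, e t.1.2 t.2 & e t.2 t.1.1]].

(** Moving the starting point along a closed walk is a permutation of these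
    walks; its orbits all have three elements, because a shorter orbit would
    consist of loops. *)
Lemma dvd3_closed3 : 3 %| #|closed3|.
Proof.
pose f (t : V * V * V) := ((t.1.2, t.2), t.1.1).
have f_inj : injective f by move=> [[a b] c] [[a' b'] c'] [-> -> ->].
have ford : closed3 \subset order_set f 3.
  apply/subsetP=> -[[a b] c]; rewrite inE /= => /and3P[ab bc ca].
  have nab : a != b by apply: contraTneq ab => ->; rewrite e_irr.
  have nbc : b != c by apply: contraTneq bc => ->; rewrite e_irr.
  have nca : c != a by apply: contraTneq ca => ->; rewrite e_irr.
  pose p := [:: ((a, b), c); ((b, c), a); ((c, a), b)].
  have p_cycle : fcycle f p by rewrite /= /f /= !eqxx.
  have p_uniq : uniq p.
    by rewrite /= !inE !xpair_eqE (negbTE nab) (negbTE nbc) (eq_sym a c)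
               (negbTE nca).
  by rewrite inE (order_cycle p_cycle p_uniq (mem_head _ _)).
have fcl : fclosed f closed3.
  apply: (intro_closed (fconnect_sym f_inj)) => t s /eqP<-.
  by rewrite !inE /=; case/and3P=> -> -> ->.
by rewrite -(fcard_order_set f_inj ford fcl) dvdn_mull.
Qed.

End Triangles.

(** The left-hand side is the trace of the cube of the adjacency matrix. *)
Lemma sum_closed3 (V : finType) (G : mixed_graph V) :
  (\sum_u \sum_v adj G u v * walks2 G v u = #|closed3 (step G)|%:R)%R.
Proof.
rewrite -sum_bool pair_big; under eq_bigr do rewrite mulr_sumr.
rewrite pair_big; apply: eq_bigr => -[[u v] w] _ /=.
by rewrite /adj; do 3!case: (step _ _ _).
Qed.

(** * The repeat of a vertex *)

Section Repeats.
Local Open Scope ring_scope.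
Variables (V : finType) (G : mixed_graph V) (r z : nat).
Hypothesis r_gt0 : (0 < r)%N.
Hypothesis z_gt0 : (0 < z)%N.
Hypothesis deg_le : forall u, (undirected_degree G u <= r)%N.
Hypothesis odeg_le : forall u, (out_degree G u <= z)%N.
Hypothesis cardV : #|V| = ((r + z) ^ 2 + z)%N.
Hypothesis diam2 : forall u v, exists2 k, is_distance G u v k & (k <= 2)%N.

(** Walks of length at most 2 from [u] to [v], without those that traverse an
    edge back and forth: for v = u these are the [undirected_degree G u] walks
    that the first summand takes away.  A pair of opposite arcs is counted. *)
Definition short_walks (u v : V) : int :=
  (v == u)%:R * (1 - (undirected_degree G u)%:R) + adj G u v + walks2 G u v.

Lemma walks2_ge0 u v : 0 <= walks2 G u v.
Proof. by apply: sumr_ge0 => w _; rewrite mulr_ge0 ?adj_ge0. Qed.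

Lemma short_walks_ge1 u v : 1 <= short_walks u v.
Proof.
rewrite /short_walks; have [->|nvu] := eqVneq v u.
  by have := closed_walks2_ge_degree G u; have := adj_ge0 G u u; lia.
rewrite mul0r add0r; have w0 := walks2_ge0 u v; have a0 := adj_ge0 G u v.
case: (diam2 u v) => k [[p [pu lp <-]] _].
case: p pu lp => [|x [|y [|//]]] /= pu lp _.
- by rewrite lp eqxx in nvu.
- by move: pu; rewrite andbT lp => uv; rewrite /adj uv in a0 *; lia.
- suff: 1 <= walks2 G u v by lia.
  move: pu; rewrite andbT lp => /andP[ux xv].
  rewrite /walks2 (bigD1 x) //= {1 2}/adj ux xv mulr1 lerDl.
  by apply: sumr_ge0 => w _; rewrite mulr_ge0 ?adj_ge0.
Qed.

Lemma sum_short_walks u :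
  \sum_v short_walks u v =
  1 + (out_degree G u)%:R +
  \sum_w adj G u w * ((undirected_degree G w)%:R + (out_degree G w)%:R).
Proof.
rewrite !big_split /= (sum_delta u (fun=> 1 - _)) (sum_adj_out G u) sum_walks2.
rewrite (eq_bigr (fun w => adj G u w *
  ((undirected_degree G w)%:R + (out_degree G w)%:R))) => [|w _].
  by rewrite addrA subrK.
by rewrite sum_adj_out.
Qed.

Lemma sum_short_walks_le u :
  \sum_v short_walks u v <=
  1 + (out_degree G u)%:R +
  ((undirected_degree G u)%:R + (out_degree G u)%:R) * (r%:R + z%:R).
Proof.
rewrite sum_short_walks lerD2l -sum_adj_out mulr_suml.
apply: ler_sum => w _; apply: ler_wpM2l; first exact: adj_ge0.
by have := deg_le w; have := odeg_le w; lia.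
Qed.

Lemma card_le_sum_short_walks u : #|V|%:R <= \sum_v short_walks u v.
Proof.
rewrite -[X in X <= _]mulr1 -(sum_const V).
by apply: ler_sum => v _; apply: short_walks_ge1.
Qed.

(** With d = r + z, a total degree at most d - 1 leaves at most
    1 + z + (d - 1) d short walks, too few for d^2 + z vertices as d > 1. *)
Lemma degrees_maximal u : undirected_degree G u = r /\ out_degree G u = z.
Proof.
have := le_trans (card_le_sum_short_walks u) (sum_short_walks_le u).
rewrite cardV; have := deg_le u; have := odeg_le u.
move: (undirected_degree G u) (out_degree G u) => a b hb ha.
rewrite -!natrD -natrM -(natrD _ 1) -natrD ler_nat => walks_le.
have : (r + z <= a + b)%N.
  rewrite leqNgt; apply/negP=> lt_ab.
  have : ((a + b).+1 * (r + z) <= (r + z) * (r + z))%N.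
    by rewrite leq_mul2r lt_ab orbT.
  by move: walks_le; rewrite mulSn -mulnn; lia.
by split; lia.
Qed.

(** There is exactly one short walk more than there are vertices, and every
    vertex is reached; y is the end of the extra walk. *)
Lemma repeat_exists u :
  exists y, forall v,
  walks2 G u v + adj G u v = 1 + (v == y)%:R + (v == u)%:R * (r%:R - 1).
Proof.
have degE v : undirected_degree G v = r by case: (degrees_maximal v).
have odegE v : out_degree G v = z by case: (degrees_maximal v).
have [||y ye] := @sum_one V (fun v => short_walks u v - 1).
- by move=> v; rewrite subr_ge0 short_walks_ge1.
- rewrite sumrB (sum_const V) sum_short_walks.
  rewrite (eq_bigr (fun w => adj G u w * (r%:R + z%:R))) => [|w _].
    by rewrite -mulr_suml sum_adj_out degE odegE cardV; lia.
  by rewrite degE odegE.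
- by exists y => v; have := ye v; rewrite /short_walks degE; lia.
Qed.

End Repeats.

(** * In-degrees and the repeat map *)

Section RepeatMap.
Local Open Scope ring_scope.
Variables (V : finType) (G : mixed_graph V) (r z : nat) (rep : V -> V).
Hypothesis r_gt0 : (0 < r)%N.
Hypothesis degE : forall u, undirected_degree G u = r.
Hypothesis odegE : forall u, out_degree G u = z.
Hypothesis cardV : #|V| = ((r + z) ^ 2 + z)%N.
Hypothesis walks_repE : forall u v,
  walks2 G u v + adj G u v = 1 + (v == rep u)%:R + (v == u)%:R * (r%:R - 1).

Local Notation d := (r%:R + z%:R : int).

Definition excess (w : V) : int := (in_degree G w)%:R - z%:R.
Definition surplus (w : V) : int := if 0 < excess w then excess w else 0.
Definition deficient (w : V) : int := (excess w < 0)%R%:R.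
Definition fibre (w : V) : int := \sum_x (w == rep x)%:R.

Lemma sum_adj_outE u : \sum_v adj G u v = d.
Proof. by rewrite sum_adj_out degE odegE. Qed.

Lemma sum_adj_inE w : \sum_u adj G u w = d + excess w.
Proof. by rewrite sum_adj_in degE /excess; lia. Qed.

Lemma walks2E u v : walks2 G u v =
  1 + (v == rep u)%:R + (v == u)%:R * (r%:R - 1) - adj G u v.
Proof. by rewrite -walks_repE addrK. Qed.

Lemma sum_excess : \sum_w excess w = 0.
Proof.
rewrite (eq_bigr (fun w => \sum_u adj G u w - d)) => [|w _].
  rewrite sumrB exchange_big -sumrB big1 // => u _.
  by rewrite sum_adj_outE subrr.
by rewrite sum_adj_inE addrC addKr.
Qed.

Lemma in_neighbour x : exists u, adj G u x = 1.
Proof.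
have : (0 < #|[set v | edge G x v]|)%N.
  by rewrite -/(undirected_degree G x) degE.
case/card_gt0P => u; rewrite inE => xu; exists u.
by rewrite /adj /step /= edge_sym xu.
Qed.

(** The commutation of A with A^2 + A - (r - 1) I = J + R, read off at the entry
    (u, w): the matrix J contributes d on one side and the column sum
    d + [excess w] on the other. *)
Lemma sum_adj_rep u w :
  \sum_x adj G u x * (w == rep x)%:R = adj G (rep u) w + excess w.
Proof.
have := walks2_assoc G u w.
rewrite (eq_bigr (fun x => adj G u x + adj G u x * (w == rep x)%:R +
  (x == w)%:R * (adj G u x * (r%:R - 1)) - adj G u x * adj G x w)) => [|x _].
  rewrite [X in _ = X](eq_bigr (fun x =>
    adj G x w + (x == rep u)%:R * adj G x w +
    (x == u)%:R * (adj G x w * (r%:R - 1)) - adj G u x * adj G x w)) => [|x _].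
    rewrite !big_split /= !sum_delta sum_adj_outE sum_adj_inE.
    move/addIr/addIr; rewrite -[in RHS]addrA => /addrI->.
    exact: addrC.
  by rewrite walks2E; ring.
by rewrite walks2E (eq_sym w x); ring.
Qed.

(** Column sums of the matrix equation; the order d^2 + z of the graph makes all
    terms free of [excess] cancel up to the constant 1. *)
Lemma fibreE w :
  fibre w = (d + 1) * excess w + 1 + \sum_x adj G x w * excess x.
Proof.
have : \sum_u (walks2 G u w + adj G u w) =
  \sum_u (1 + (w == rep u)%:R + (u == w)%:R * (r%:R - 1)).
  by apply: eq_bigr => u _; rewrite walks_repE (eq_sym u).
have -> : \sum_u (walks2 G u w + adj G u w) =
  (d + excess w) * d + \sum_x adj G x w * excess x + (d + excess w).
  rewrite big_split /= sum_adj_inE; congr (_ + _).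
  rewrite exchange_big -(sum_adj_inE w) mulr_suml -big_split.
  by apply: eq_bigr => x _; rewrite -mulr_suml sum_adj_inE /=; ring.
rewrite !big_split /= -/(fibre w) (sum_const V) cardV sum_delta.
rewrite natrD natrX natrD.
nia.
Qed.



(** In [sum_adj_rep] the left-hand side is nonnegative and [adj] is at most 1,
    so a negative excess forces the values -1 and 1.  The left-hand side is
    then zero for all u, and each x is an out-neighbour of some u. *)
Lemma deficientP w : excess w < 0 ->
  [/\ excess w = -1, forall u, adj G (rep u) w = 1 & forall x, w != rep x].
Proof.
move=> ew.
have term_ge0 u x : 0 <= adj G u x * (w == rep x)%:R.
  by rewrite mulr_ge0 ?adj_ge0 ?ler0n.
have sum_ge0 u : 0 <= \sum_x adj G u x * (w == rep x)%:R by apply: sumr_ge0.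
have e1 : excess w = -1.
  have := sum_ge0 w; rewrite sum_adj_rep; have := adj_le1 G (rep w) w; lia.
have a1 u : adj G (rep u) w = 1.
  by have := sum_ge0 u; rewrite sum_adj_rep; have := adj_le1 G (rep u) w; lia.
split=> // x; have [u ux] := in_neighbour x.
have s0 : \sum_x adj G u x * (w == rep x)%:R = 0 by rewrite sum_adj_rep a1 e1.
have := psumr_eq0P (fun x _ => term_ge0 u x) s0 (i := x) isT.
by rewrite ux mul1r; case: eqP.
Qed.

Lemma excess_split w : excess w = surplus w - deficient w.
Proof.
rewrite /surplus /deficient; case: (ltrgtP (excess w) 0) => [ew|ew|->] /=.
- by have [-> _ _] := deficientP ew.
- by rewrite subr0.
- by [].
Qed.

Lemma sum_surplus : \sum_w surplus w = \sum_w deficient w.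
Proof.
apply/eqP; rewrite -subr_eq0 -sumrB.
by rewrite -(eq_bigr _ (fun w _ => excess_split w)) sum_excess.
Qed.

Lemma surplus_ge w : excess w <= surplus w.
Proof. by rewrite /surplus; case: ltP. Qed.

Lemma surplus_ge0 w : 0 <= surplus w.
Proof. by rewrite /surplus; case: ltP => // /ltW. Qed.

Lemma deficient_le_adj u v : deficient v <= adj G (rep u) v.
Proof.
rewrite /deficient; case: ltP => [ev|_]; last exact: adj_ge0.
by have [_ -> _] := deficientP ev.
Qed.

Lemma adj_excess_le x w : adj G x w * excess x <= surplus x.
Proof.
rewrite /adj; case: (step _ _ _); first by rewrite mul1r surplus_ge.
by rewrite mul0r surplus_ge0.
Qed.

Lemma sum_adj_excess w : excess w < 0 -> \sum_x adj G x w * excess x = d.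
Proof.
case/deficientP=> e1 _ w_rep; have := fibreE w; rewrite e1 /fibre big1.
  by move=> H; lia.
by move=> x _; rewrite (negbTE (w_rep x)).
Qed.

(** The chain of bounds: d is at most the total surplus, which equals the number
    of deficient vertices, which is at most the out-degree d of a repeat. *)
Lemma sum_deficient w : excess w < 0 -> \sum_v deficient v = d.
Proof.
move=> ew; apply/eqP; rewrite eq_le; apply/andP; split.
  rewrite -(sum_adj_outE (rep w)).
  by apply: ler_sum => v _; apply: deficient_le_adj.
rewrite -sum_surplus -(sum_adj_excess ew).
by apply: ler_sum => x _; apply: adj_excess_le.
Qed.

(** * The structure forced by a deficient vertex *)

Section Irregular.
Variable w0 : V.
Hypothesis w0_deficient : excess w0 < 0.

Lemma adj_rep u v : adj G (rep u) v = deficient v.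
Proof.
symmetry; move: v; apply: sum_le_eq; first exact: deficient_le_adj.
by rewrite sum_adj_outE (sum_deficient w0_deficient).
Qed.

(** As the row of a repeat is the indicator of the deficient vertices, the
    right-hand side of [sum_adj_rep] loses its dependence on u. *)
Lemma sum_adj_rep_surplus u w :
  \sum_x adj G u x * (w == rep x)%:R = surplus w.
Proof. by rewrite sum_adj_rep adj_rep excess_split addrCA subrr addr0. Qed.

(** A repeat [rep x] is counted in [sum_adj_rep_surplus] at any in-neighbour u
    of x. *)
Lemma excess_rep x : 0 < excess (rep x).
Proof.
have [u ux] := in_neighbour x; have := sum_adj_rep_surplus u (rep x).
rewrite (bigD1 x) //= ux eqxx mul1r /surplus; case: ltP => // _ /eqP.
rewrite paddr_eq0 // sumr_ge0 // => y _.
by rewrite mulr_ge0 ?adj_ge0 ?ler0n.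
Qed.

Lemma surplus_repeat x : 0 < excess x -> exists y, x = rep y.
Proof.
move=> ex; have [y /eqP|no] := pickP (fun y => x == rep y); first by exists y.
have := sum_adj_rep_surplus x x.
rewrite big1 => [|y _]; last by rewrite no mulr0.
by rewrite /surplus ex => e0; rewrite -e0 in ex.
Qed.

Lemma adj_surplus x v : 0 < excess x -> adj G x v = deficient v.
Proof. by case/surplus_repeat=> y ->; apply: adj_rep. Qed.

(** The in-neighbours of a vertex x of positive excess among the deficient
    vertices are exactly its neighbours along edges.  The deficient vertices
    are the out-neighbours of x, so an arc y -> x from one of them would close
    a walk y -> x -> y; then y would be its own repeat, but deficient vertices
    are not repeats. *)
Lemma adj_surplus_in x y : 0 < excess x ->
  adj G y x * excess y = - (edge G x y)%:R.
Proof.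
move=> ex; have [ey|ey|ey] := ltrgtP (excess y) 0.
- have [-> _ y_rep] := deficientP ey; rewrite mulrN1; congr (- _).
  have xy : adj G x y = 1 by rewrite adj_surplus // /deficient ey.
  rewrite adjE edge_sym; case yx: (arc G y x); last by rewrite addr0.
  have exy : edge G x y = false.
    by apply/negP; rewrite edge_sym => /edge_arc_excl; rewrite yx.
  (* The r edges at y, and the walk through x on top of them. *)
  have : \sum_v ((edge G y v)%:R + (v == x)%:R * 1) <= walks2 G y y.
    apply: ler_sum => v _; have [->|nvx] := eqVneq v x.
      by rewrite edge_sym exy mul1r xy mulr1 adjE yx; lia.
    rewrite mul0r addr0 !adjE (edge_sym G v y).
    by case: (edge G y v); case: (arc G y v); case: (arc G v y).
  rewrite big_split /= sum_edge degE (sum_delta x (fun=> 1)) walks2E.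
  rewrite (negbTE (y_rep y)) eqxx mul1r.
  by have := adj_ge0 G y y; lia.
- have := adj_surplus y ex; rewrite /deficient ltNge ltW //= => xy.
  have := adj_surplus x ey; rewrite /deficient ltNge ltW //= => ->.
  by move: xy; rewrite adjE mul0r; case: (edge G x y) => //=; case: (arc G x y).
- have := adj_surplus y ex; rewrite /deficient ey ltxx mulr0 adjE.
  by case: (edge G x y) => //=; case: (arc G x y).
Qed.

(** Walks x -> y -> x pass through deficient vertices y, so that y -> x is an
    edge by [adj_surplus_in]. *)
Lemma closed_walks2_surplus x : 0 < excess x -> walks2 G x x = r%:R.
Proof.
move=> ex; rewrite -(degE x) -sum_edge; apply: eq_bigr => y _.
rewrite adj_surplus // /deficient; have xy := adj_surplus_in y ex.
case: ltP => [ey|ey].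
  by have [e1 _ _] := deficientP ey; rewrite e1 in xy; rewrite mul1r; lia.
rewrite mul0r; have := adj_ge0 G y x; case: (edge G x y) xy => //=; nia.
Qed.

Lemma rep_neq u : u != rep u.
Proof.
apply/eqP=> u_rep; have eu : 0 < excess u by rewrite u_rep excess_rep.
have := closed_walks2_surplus eu; rewrite walks2E -u_rep !eqxx adj_surplus //.
by rewrite /deficient ltNge ltW //=; lia.
Qed.

Lemma fibre_surplus x :
  fibre x = (d + 1) * surplus x + (1 - r%:R) * (0 < excess x)%R%:R.
Proof.
rewrite /surplus; case: ltP => [ex|ex].
  rewrite fibreE (eq_bigr (fun y => - (edge G x y)%:R)) => [|y _].
    by rewrite sumrN sum_edge degE; lia.
  exact: adj_surplus_in.
rewrite !mulr0 /fibre big1 // => y _; case: eqP => // xy.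
by move: ex; rewrite xy leNgt excess_rep.
Qed.

(** Adding up [fibre_surplus] counts the vertices: with p vertices of positive
    excess, d^2 + z = (d + 1) d + (1 - r) p, that is (p - 1) (r - 1) = 1. *)
Lemma undirected_degree_eq2 : r = 2%N.
Proof.
have : \sum_x fibre x = #|V|%:R.
  rewrite exchange_big -[RHS]mulr1 -(sum_const V); apply: eq_bigr => y _.
  rewrite -[RHS](sum_delta (rep y) (fun=> 1)).
  by apply: eq_bigr => x _; rewrite mulr1.
rewrite (eq_bigr _ (fun x _ => fibre_surplus x)) big_split /= -!mulr_sumr.
rewrite sum_surplus (sum_deficient w0_deficient) sum_bool cardV.
move: #|_| => p; rewrite natrD natrX natrD => H.
have {H}pr : (p * r = p + r)%N by nia.
have p2 : (1 < p)%N by move: pr r_gt0; case: p => [|[|p]] //; lia.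
nia.
Qed.

(** Multiply A^2 = J + R + (r - 1) I - A by A and read off the diagonal entry at
    u: J gives d, R gives [surplus u] by [sum_adj_rep_surplus], I gives nothing
    as there are no loops, and A^2 takes away exactly r because u is not its
    own repeat. *)
Lemma sum_closed_walks3 :
  (#|closed3 (step G)|%:R = #|V|%:R * z%:R + d)%R.
Proof.
rewrite -sum_closed3.
rewrite (eq_bigr (fun u => d + surplus u - r%:R)) => [|u _].
  rewrite sumrB big_split /= sum_surplus (sum_deficient w0_deficient).
  by rewrite !(sum_const V); ring.
rewrite (eq_bigr (fun v => adj G u v + adj G u v * (u == rep v)%:R +
  (v == u)%:R * (adj G u v * (r%:R - 1)) - adj G u v * adj G v u)) => [|v _].
  rewrite sumrB !big_split /= sum_adj_outE sum_adj_rep_surplus sum_delta.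
  rewrite -/(walks2 G u u) walks2E eqxx (negbTE (rep_neq u)).
  by rewrite {1 2}/adj /step /= edge_irr arc_irr; lia.
by rewrite walks2E (eq_sym u v); ring.
Qed.

Lemma no_deficient : False.
Proof.
have d3 := dvd3_closed3 (e := step G).
have step_irr : irreflexive (step G).
  by move=> u; rewrite /step /= edge_irr arc_irr.
move: {d3}(d3 step_irr) sum_closed_walks3.
rewrite cardV undirected_degree_eq2 => d3.
rewrite -natrM -!natrD => /eqP; rewrite eqr_nat => /eqP E.
move: d3; rewrite E.
(* For z congruent to 0, 1, 2 the count is 2, 1, 1 modulo 3. *)
rewrite (divn_eq z 3) -mulnn.
move: (z %/ 3)%N (ltn_pmod z (isT : 0 < 3)%N) => q.
by case: (z %% 3)%N => [|[|[|]]] // _; lia.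
Qed.

End Irregular.

Lemma in_degreeE w : in_degree G w = z.
Proof.
have ge0 v : 0 <= excess v.
  by rewrite leNgt; apply/negP => /no_deficient.
have := psumr_eq0P (fun v _ => ge0 v) sum_excess (i := w) isT.
by rewrite /excess; lia.
Qed.

End RepeatMap.

Theorem theorem2p8 (r z : nat) (hr : 1 <= r) (hz : 1 <= z)
  (V : finType) (G : mixed_graph V) (hG : almost_mixed_moore2 G r z) :
  totally_regular G.
Proof.
have [_ rE zE [diam2 _] cardV] := hG.
have deg_le u : undirected_degree G u <= r by rewrite -rE leq_bigmax.
have odeg_le u : out_degree G u <= z by rewrite -zE leq_bigmax.
have {}cardV : #|V| = (r + z) ^ 2 + z.
  by rewrite cardV /mixed_moore_bound2 addnK.
have degs := degrees_maximal hr hz deg_le odeg_le cardV diam2.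
have degE u : undirected_degree G u = r by case: (degs u).
have odegE u : out_degree G u = z by case: (degs u).
have [rep repE] :=
  fin_all_exists (repeat_exists hr hz deg_le odeg_le cardV diam2).
split=> [u v|u]; first by rewrite !degE !odegE.
by rewrite odegE (in_degreeE hr degE odegE cardV repE).
Qed.
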